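(* Let $W \subset \mathbb{R}^2$ be the Warsaw Circle. Then the zeroth Milnor-Thurston homology group $\mathcal{H}_0(W)$, equipped with the Berlanga topology, is not a Hausdorff space.
   Context: The Warsaw Circle $W \subset \mathbb{R}^2$ is the union of: the portion of the topologist's sine curve $\{(x,y) : y = \sin(1/x),\ x>0\}$ between the line $x=0$ and its rightmost minimum; the segment $\{(0,y) : -1 \leq y \leq 1\}$; and an arc (disjoint from the rest except at endpoints) joining $(0,-1)$ to that rightmost minimum. Milnor-Thurston (measure) homology: for a topological space $X$ and integer $k \geq 0$, let $C^0(\Delta^k, X)$ be the space of continuous maps from the standard $k$-simplex $\Delta^k$ to $X$, with the compact-open topology. $\mathcal{C}_k(X)$ is the real vector space of finite signed Borel measures on $C^0(\Delta^k,X)$ admitting a compact carrier (a set whose complement contains only Borel sets of measure zero). The boundary $\partial : \mathcal{C}_k(X) \to \mathcal{C}_{k-1}(X)$ is $\partial = \sum_{i=0}^k (-1)^i \partial_i$, where $\partial_i \mu$ is the image measure $A \mapsto \mu(\{\sigma : \sigma\circ\delta_i \in A\})$, with $\delta_i : \Delta^{k-1} \to \Delta^k$ the standard inclusion of the $i$-th face. Let $\mathcal{Z}_k(X)$ and $\mathcal{B}_k(X)$ be the cycles and boundaries; $\mathcal{H}_k(X) = \mathcal{Z}_k(X)/\mathcal{B}_k(X)$ is the Milnor-Thurston homology. Berlanga topology (for $X$ second countable and separable, such as $W$): for each continuous function $f : C^0(\Delta^k, X) \to \mathbb{R}$ consider the linear functional $\Lambda_f(\mu) = \int_{C^0(\Delta^k,X)}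 f\, d\mu$ on $\mathcal{C}_k(X)$; give $\mathcal{C}_k(X)$ the weakest topology making all $\Lambda_f$ continuous (a locally convex vector space topology). Give $\mathcal{Z}_k(X)$ and $\mathcal{B}_k(X)$ the subspace topologies and $\mathcal{H}_k(X)$ the quotient topology; this is the Berlanga topology on $\mathcal{H}_k(X)$. *)

(* Defs.v *)
From HB Require Import structures.
From mathcomp Require Import all_boot all_order all_algebra.
From mathcomp Require Import all_classical all_reals all_analysis.

Set Implicit Arguments.
Unset Strict Implicit.
Unset Printing Implicit Defensive.
Import Order.TTheory GRing.Theory Num.Theory.
Import numFieldNormedType.Exports.
Local Open Scope classical_set_scope.
Local Open Scope ring_scope.

Definition gen_open {T : Type} (S : set (set T)) : set (set T) :=
  [set U | forall x, U x -> exists (n : nat) (A : nat -> set T),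
      (forall i, (i < n)%N -> S (A i)) /\ (forall i, (i < n)%N -> A i x) /\
      (forall y, (forall i, (i < n)%N -> A i y) -> U y)].

Definition compact_for {T : Type} (O : set (set T)) (K : set T) : Prop :=
  forall F : set (set T), F `<=` O -> K `<=` \bigcup_(A in F) A ->
    exists (n : nat) (A : nat -> set T),
      (forall i, (i < n)%N -> F (A i)) /\ K `<=` \bigcup_(i in [set i | (i < n)%N]) A i.

Section Warsaw.
Variable R : realType.

(** rightmost minimum of sin(1/x): x = 2/(3 pi) *)
Definition xmin : R := 2 / (3 * pi).

Definition sine_part : set (R * R) :=
  [set p | exists x : R, 0 < x <= xmin /\ p = (x, sin (x^-1))].

Definition vert_segment : set (R * R) :=
  [set p | p.1 = 0 /\ -1 <= p.2 <= 1].

Definition warsaw_arc (gamma : R -> R * R) : Prop :=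
  {within `[0, 1], continuous gamma} /\
  {in `[0, 1] &, injective gamma} /\
  gamma 0 = (0, -1) /\ gamma 1 = (xmin, sin (xmin^-1)) /\
  (forall s, 0 < s < 1 -> ~ sine_part (gamma s) /\ ~ vert_segment (gamma s)).

Definition warsaw (gamma : R -> R * R) : set (R * R) :=
  sine_part `|` vert_segment `|` gamma @` `[0, 1].

Definition is_simplex (k : nat) (t : 'rV[R]_k.+1) : bool :=
  [forall j, 0 <= t ord0 j] && (\sum_j t ord0 j == 1).

Definition simplex (k : nat) := {t : 'rV[R]_k.+1 | is_simplex t}.

Definition cont_on_simplex (k : nat) (s : simplex k -> R * R) : Prop :=
  forall U : set (R * R), open U ->
    exists V : set 'rV[R]_k.+1, open V /\ s @^-1` U = (@sval _ _) @^-1` V.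

Variable gamma : R -> R * R.

Record cmap (k : nat) := CMap {
  cm_fun :> simplex k -> R * R;
  cm_cont : cont_on_simplex cm_fun;
  cm_in : forall t, warsaw gamma (cm_fun t) }.

Lemma origin_in_warsaw : warsaw gamma (0, 0).
Proof.
left; right; split => //=; rewrite lerN10 /= ler01 //.
Qed.

Lemma const_cont (k : nat) : cont_on_simplex (fun _ : simplex k => ((0 : R), (0 : R))).
Proof.
move=> U _; case: (pselect (U (0, 0))) => H.
  by exists setT; split; [exact: openT|]; apply/seteqP; split.
by exists set0; split; [exact: open0|]; apply/seteqP; split.
Qed.

Definition cmap0 (k : nat) : cmap k :=
  @CMap k (fun _ => (0, 0)) (@const_cont k) (fun _ => origin_in_warsaw).

HB.instance Definition _ k := gen_eqMixin (cmap k).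
HB.instance Definition _ k := gen_choiceMixin (cmap k).
HB.instance Definition _ k := isPointed.Build (cmap k) (cmap0 k).

Definition co_subbasis (k : nat) : set (set (cmap k)) :=
  [set S | exists (K : set 'rV[R]_k.+1) (V : set (R * R)),
      compact K /\ K `<=` [set (sval t) | t in [set: simplex k]] /\ open V /\
      S = [set s : cmap k | forall t : simplex k, K (sval t) ->
                             (warsaw gamma `&` V) (s t)]].

Definition co_open (k : nat) : set (set (cmap k)) := gen_open (@co_subbasis k).

Definition cmapB (k : nat) := g_sigma_algebraType (@co_open k).

(** A finite signed Borel measure is represented by its (real) values on
    Borel sets; it is normalised to be 0 on non-Borel sets. *)
Definition signed_measure (k : nat) (mu : set (cmapB k) -> R) : Prop :=
  (forall A, ~ measurable A -> mu A = 0) /\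
  mu set0 = 0 /\
  (forall F : nat -> set (cmapB k), (forall n, measurable (F n)) ->
     trivIset setT F ->
     (fun n => \sum_(i < n) mu (F i)) @ \oo --> mu (\bigcup_n F n)).

Definition compact_carrier (k : nat) (mu : set (cmapB k) -> R) : Prop :=
  exists K : set (cmapB k), compact_for (@co_open k) K /\
    (forall A, measurable A -> A `&` K = set0 -> mu A = 0).

Definition chains (k : nat) : set (set (cmapB k) -> R) :=
  [set mu | signed_measure mu /\ compact_carrier mu].

Definition delta (k : nat) (i : 'I_k.+2) (t : 'rV[R]_k.+1) : 'rV[R]_k.+2 :=
  \row_j (match unlift i j with Some j' => t ord0 j' | None => 0 end).

Definition ext_simplex (k : nat) (s : simplex k -> R * R) (v : 'rV[R]_k.+1) : R * R :=
  match insub v with Some t => s t | None => (0, 0) end.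

Definition face_fun (k : nat) (i : 'I_k.+2) (s : cmap k.+1) : simplex k -> R * R :=
  fun t => ext_simplex s (delta i (sval t)).

Definition face_preim (k : nat) (i : 'I_k.+2) (A : set (cmapB k)) : set (cmapB k.+1) :=
  [set s : cmap k.+1 | exists tau : cmap k, A tau /\ cm_fun tau = face_fun i s].

Definition bd (k : nat) (mu : set (cmapB k.+1) -> R) : set (cmapB k) -> R :=
  fun A => if `[< measurable A >] then
             \sum_(i < k.+2) (-1) ^+ i * mu (face_preim i A)
           else 0.

Definition boundaries (k : nat) : set (set (cmapB k) -> R) :=
  [set @bd k mu | mu in @chains k.+1].

(** Z_0 = C_0 (the boundary C_0 -> C_(-1) = 0 is zero) *)
Definition cycles0 : set (set (cmapB 0) -> R) := @chains 0.

Definition cont_fun (k : nat) (f : cmap k -> R) : Prop :=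
  forall U : set R, open U -> co_open (f @^-1` U).

(** Integral w.r.t. a signed measure, via the Jordan decomposition
    mu = mu^+ - mu^-, mu^+(A) = sup{mu(B) | B Borel, B subset A}. *)
Definition mu_pos (k : nat) (mu : set (cmapB k) -> R) : set (cmapB k) -> \bar R :=
  fun A => ereal_sup [set (mu B)%:E | B in [set B | measurable B /\ B `<=` A]].
Definition mu_neg (k : nat) (mu : set (cmapB k) -> R) : set (cmapB k) -> \bar R :=
  fun A => ereal_sup [set (- mu B)%:E | B in [set B | measurable B /\ B `<=` A]].

Definition Lambda (k : nat) (f : cmap k -> R) (mu : set (cmapB k) -> R) : R :=
  fine (\int[mu_pos mu]_x (f x)%:E) - fine (\int[mu_neg mu]_x (f x)%:E).

(** open sets of C_k(W) in the weakest topology making all Lambda_f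
    (f continuous) continuous *)
Definition berlanga_open (k : nat) : set (set (set (cmapB k) -> R)) :=
  [set O | O `<=` @chains k /\
    forall mu, O mu -> exists (n : nat) (f : nat -> cmap k -> R) (U : nat -> set R),
      (forall i, (i < n)%N -> cont_fun (f i) /\ open (U i) /\ U i (Lambda (f i) mu)) /\
      (forall nu, @chains k nu -> (forall i, (i < n)%N -> U i (Lambda (f i) nu)) -> O nu)].

Definition Z0_open : set (set (set (cmapB 0) -> R)) :=
  [set O | exists O', berlanga_open O' /\ O = O' `&` cycles0].

Definition coset0 (z : set (cmapB 0) -> R) : set (set (cmapB 0) -> R) :=
  [set nu | exists b, @boundaries 0 b /\ nu = (fun A => z A + b A)].

Definition H0 : set (set (set (cmapB 0) -> R)) := [set coset0 z | z in cycles0].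

Definition H0_open : set (set (set (set (cmapB 0) -> R))) :=
  [set UU | UU `<=` H0 /\ Z0_open [set z | cycles0 z /\ UU (coset0 z)]].

Definition H0_hausdorff : Prop :=
  forall c1 c2, H0 c1 -> H0 c2 -> c1 <> c2 ->
    exists UU VV, H0_open UU /\ H0_open VV /\ UU c1 /\ VV c2 /\ UU `&` VV = set0.

End Warsaw.

(* Main.v *)
Require Import Defs.
From HB Require Import structures.
From mathcomp Require Import all_boot all_order all_algebra.
From mathcomp Require Import all_classical all_reals all_analysis.
From mathcomp Require Import measurable_realfun ring lra.

(** The witness is the measure z = sum_n w_n (delta_(p_(n+1)) - delta_(p_0)),
    with w_n = 1 / ((n+1)(n+2)) and p_n the points of the sine curve with
    1/x = 2 pi (n+1), which converge to the origin. Its finite truncations are boundaries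
    of finite sums of arcs of the curve, and their Lambda-integrals converge to
    those of z, so every neighbourhood of the class of z contains 0.

    But z is not a boundary. Let T_n be the part of the sine curve to the left
    of its n-th minimum; it is relatively open in W. A path from T_(n+1)
    leaves T_n only after traversing a whole oscillation, since it cannot reach
    the limit segment continuously along the curve; hence paths in a compact
    family starting in T_(n+N) end in T_n, for some uniform N. If z = bd mu with mu carried by such
    a family, then z(T_n) = mu(E \ E') - mu(E' \ E), where E and E' are the sets
    of paths ending, resp. starting, in T_n. For n running through a
    progression of step N + 1 the sets E \ E' are disjoint up to null sets, so
    countable additivity makes the values z(T_n) summable along the
    progression; yet z(T_n) >= 1 / (2n). *)

Set Implicit Arguments.
Unset Strict Implicit.
Unset Printing Implicit Defensive.
Import Order.TTheory GRing.Theory Num.Theory.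
Import numFieldNormedType.Exports.
Local Open Scope classical_set_scope.
Local Open Scope ring_scope.

(** * Measures made of countably many atoms *)

Import HBNNSimple.

(** [Lambda] integrates against [mu_pos] and [mu_neg], which are bare set functions. An integral
    reads a set function only on measurable sets, so agreement there lets genuine measures take
    their place. *)
Lemma integral_set_fun_ext d (T : measurableType d) (R : realType)
    (m1 m2 : set T -> \bar R) (f : T -> \bar R) :
  (forall A, measurable A -> m1 A = m2 A) ->
  (\int[m1]_x f x = \int[m2]_x f x)%E.
Proof.
move=> m12; rewrite /integral.
have E (g : T -> \bar R) :
    [set sintegral m1 h | h in
      [set h : {nnsfun T >-> R} | (forall x, (h x)%:E <= g x)%E]] =
    [set sintegral m2 h | h in
      [set h : {nnsfun T >-> R} | (forall x, (h x)%:E <= g x)%E]].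
  by apply: eq_imagel => h _; apply: eq_fsbigr => r _; rewrite m12.
by congr (ereal_sup _ - ereal_sup _)%E; exact: E.
Qed.

Section Atomic.
Context d (T : measurableType d) (R : realType).
Variables (b : nat -> {nonneg R}) (q : nat -> T).
Hypothesis bfin : (\sum_(0 <= n <oo) (b n)%:num%:E < +oo)%E.

Definition atom (n : nat) : {measure set T -> \bar R} :=
  mscale (b n) (dirac (q n)).

Definition atoms : {measure set T -> \bar R} := mseries atom 0.

Definition atoms_upto (N : nat) : {measure set T -> \bar R} := msum atom N.

Lemma atomE n A : atom n A = ((b n)%:num * \1_A (q n))%:E.
Proof. by rewrite /atom /= /mscale /= diracE -indicE EFinM. Qed.

Lemma atoms_uptoE N A :
  atoms_upto N A = (\sum_(n < N) (b n)%:num * \1_A (q n))%:E.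
Proof.
rewrite /atoms_upto /= /msum -sumEFin.
by apply: eq_bigr => n _; rewrite -atomE.
Qed.

Lemma atoms_finite A : measurable A -> (atoms A < +oo)%E.
Proof.
move=> mA; apply: le_lt_trans bfin.
apply: lee_nneseries => [n _ _|n _]; first exact: measure_ge0.
by rewrite atomE lee_fin ler_piMr// indicE; case: (_ \in _); rewrite ?ler01.
Qed.

Lemma atoms_upto_le N A : measurable A -> (atoms_upto N A <= atoms A)%E.
Proof.
move=> mA; rewrite /atoms_upto /atoms /= /msum /mseries -(big_mkord xpredT (fun n => atom n A)).
by apply: nneseries_lim_ge => n _ _; exact: measure_ge0.
Qed.

Lemma ge0_integral_atoms_upto (f : T -> \bar R) (N : nat) :
  measurable_fun setT f -> (forall x, 0 <= f x)%E ->
  (\int[atoms_upto N]_x f x = \sum_(n < N) (b n)%:num%:E * f (q n))%E.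
Proof.
move=> mf f0; rewrite ge0_integral_measure_sum//; apply: eq_bigr => n _.
by rewrite ge0_integral_mscale// integral_dirac// diracT mul1e.
Qed.

Lemma ge0_integral_atoms (f : T -> \bar R) :
  measurable_fun setT f -> (forall x, 0 <= f x)%E ->
  (\int[atoms]_x f x = \sum_(0 <= n <oo) (b n)%:num%:E * f (q n))%E.
Proof.
move=> mf f0; rewrite ge0_integral_measure_series//; apply: eq_eseriesr => n _.
by rewrite ge0_integral_mscale// integral_dirac// diracT mul1e.
Qed.

(** The integrals are the sum and the partial sums of one series of nonnegative terms, dominated by
    the summable [C * b n]. A bound on [f] at the atoms alone is enough. *)
Lemma ge0_integral_atoms_cvg (f : T -> \bar R) (C : R) :
  measurable_fun setT f -> (forall x, 0 <= f x)%E ->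
  (forall n, f (q n) <= C%:E)%E ->
  (\int[atoms]_x f x \is a fin_num)%E /\
  (forall N, \int[atoms_upto N]_x f x \is a fin_num)%E /\
  (fun N => \int[atoms_upto N]_x f x)%E @ \oo --> (\int[atoms]_x f x)%E.
Proof.
move=> mf f0 fC.
have C0 : 0 <= C by rewrite -lee_fin (le_trans (f0 (q 0%N))).
have pos n : (0 <= (b n)%:num%:E * f (q n))%E by rewrite mule_ge0.
have fin : (\int[atoms]_x f x \is a fin_num)%E.
  rewrite ge0_fin_numE; last exact: integral_ge0.
  rewrite ge0_integral_atoms//.
  apply: (@le_lt_trans _ _ (\sum_(0 <= n <oo) C%:E * (b n)%:num%:E)%E).
    by apply: lee_nneseries => // n _; rewrite muleC lee_wpmul2r// lee_fin.
  rewrite nneseriesZl//.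
  by apply: lte_mul_pinfty => //; rewrite lee_fin.
split => //; split=> [N|].
  rewrite ge0_fin_numE; last exact: integral_ge0.
  rewrite ge0_integral_atoms_upto// -(big_mkord xpredT (fun n => (b n)%:num%:E * f (q n)))%E.
  apply: le_lt_trans (_ : \int[atoms]_x f x < +oo)%E.
    by rewrite ge0_integral_atoms//; apply: nneseries_lim_ge.
  by rewrite -ge0_fin_numE//; exact: integral_ge0.
rewrite ge0_integral_atoms//.
have /cvg_ex[l lP] : cvgn (fun N => \sum_(0 <= n < N) (b n)%:num%:E * f (q n))%E.
  by apply: is_cvg_nneseries => n _ _.
rewrite (cvg_lim _ lP)//.
by under eq_fun => N do rewrite ge0_integral_atoms_upto//
  -(big_mkord xpredT (fun n => (b n)%:num%:E * f (q n)))%E.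
Qed.

Lemma integral_atoms_cvg (f : T -> R) (C : R) :
  measurable_fun setT f -> (forall n, `|f (q n)| <= C) ->
  (fun N => fine (\int[atoms_upto N]_x (f x)%:E)%E) @ \oo -->
    fine (\int[atoms]_x (f x)%:E)%E.
Proof.
move=> mf fC.
have mEf : measurable_fun setT (EFin \o f) by apply/measurable_EFinP.
have C0 : 0 <= C by exact: le_trans (normr_ge0 _) (fC 0%N).
have fpC n : ((EFin \o f)^\+ (q n) <= C%:E)%E.
  by rewrite funeposE ge_max !lee_fin C0 (le_trans (ler_norm _)).
have fnC n : ((EFin \o f)^\- (q n) <= C%:E)%E.
  by rewrite funenegE ge_max !lee_fin C0 andbT (le_trans (ler_norm _))// normrN.
have [p1 [p2 p3]] := ge0_integral_atoms_cvg
  (measurable_funepos mEf) (fun x => funepos_ge0 _ x) fpC.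
have [n1 [n2 n3]] := ge0_integral_atoms_cvg
  (measurable_funeneg mEf) (fun x => funeneg_ge0 _ x) fnC.
apply: fine_cvg; rewrite fineK.
  rewrite integralE; under eq_fun => N do rewrite integralE.
  by apply: cvgeB => //; rewrite fin_num_adde_defl// fin_numN.
by rewrite integralE fin_numB p1 n1.
Qed.

End Atomic.

Section AtomsNull.
Context d (T : measurableType d) (R : realType).
Variables (b : nat -> {nonneg R}) (q : nat -> T) (A : set T).
Hypothesis qA : forall n, ~ A (q n).

Let atom0 n : atom b q n A = 0%E.
Proof. by rewrite atomE indicE memNset// mulr0. Qed.

Lemma atoms_null : atoms b q A = 0%E.
Proof. by rewrite /atoms /= /mseries eseries0. Qed.

Lemma atoms_upto_null N : atoms_upto b q N A = 0%E.
Proof. by rewrite /atoms_upto /= /msum big1. Qed.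

End AtomsNull.

Lemma indic_iff (R : nzRingType) T U (A : set T) (B : set U) x y :
  (A x <-> B y) -> \1_A x = \1_B y :> R.
Proof.
move=> AB; rewrite !indicE; congr ((nat_of_bool _)%:R).
by apply/idP/idP; rewrite !inE => /AB.
Qed.

(** * Signed measures and their Jordan decomposition *)

Section SignedMeasures.
Variables (R : realType) (gamma : R -> R * R) (k : nat).
Local Notation T := (cmapB gamma k).

(** The value 0 off the Borel sets is the normalisation required by [signed_measure]. *)
Definition real_measure (m : {measure set T -> \bar R}) (A : set T) : R :=
  if `[< measurable A >] then fine (m A) else 0.

Lemma real_measureE (m : {measure set T -> \bar R}) A :
  measurable A -> real_measure m A = fine (m A).
Proof. by move=> mA; rewrite /real_measure asboolT. Qed.

Lemma finite_measure_fin_num (m : {measure set T -> \bar R}) A :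
  (m setT < +oo)%E -> measurable A -> (m A \is a fin_num)%E.
Proof.
move=> mT mA; rewrite ge0_fin_numE ?measure_ge0//; apply: le_lt_trans mT.
by apply: le_measure; rewrite ?inE//; exact: measurableT.
Qed.

Lemma signed_real_measure (m : {measure set T -> \bar R}) :
  (m setT < +oo)%E -> signed_measure (real_measure m).
Proof.
move=> mT; split=> [A nA|]; first by rewrite /real_measure asboolF.
split=> [|F mF tF]; first by rewrite real_measureE ?measure0//; exact: measurable0.
have mU : measurable (\bigcup_n F n) by exact: bigcup_measurable.
rewrite real_measureE//.
have := @measure_sigma_additive _ _ _ m F mF tF.
rewrite -[X in _ --> X -> _](fineK (finite_measure_fin_num mT mU)).
move=> /fine_cvg; apply: cvg_trans; apply: near_eq_cvg; near=> n.
rewrite /= big_mkord -sum_fine; last by move=> i _; exact: finite_measure_fin_num.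
by apply: eq_bigr => i _; rewrite real_measureE.
Unshelve. all: by end_near. Qed.

Lemma signed_measureB (mu nu : set T -> R) : signed_measure mu ->
  signed_measure nu -> signed_measure (fun A => mu A - nu A).
Proof.
move=> [mu1 [mu2 mu3]] [nu1 [nu2 nu3]]; split=> [A nA|].
  by rewrite mu1// nu1// subr0.
split=> [|F mF tF]; first by rewrite mu2 nu2 subr0.
under eq_fun do rewrite sumrB.
exact: cvgB (mu3 F mF tF) (nu3 F mF tF).
Qed.

(** Countable additivity is applied to [A], [B] and then empty sets; the partial sums are constant
    from the second on. *)
Lemma signed_measureU (mu : set T -> R) A B : signed_measure mu ->
  measurable A -> measurable B -> A `&` B = set0 ->
  mu (A `|` B) = mu A + mu B.
Proof.
move=> [_ [mu0 muS]] mA mB AB.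
have mF n : measurable (bigcup2 A B n).
  by case: n => [|[|n]]//=; exact: measurable0.
have tF : trivIset setT (bigcup2 A B) by rewrite -trivIset_bigcup2.
have := muS _ mF tF; rewrite bigcup2E => h; rewrite -(cvg_lim _ h)//; apply: cvg_lim => //.
apply: cvg_near_cst; near=> n.
have n2 : (2 <= n)%N by near: n; exists 2%N.
rewrite -(big_mkord xpredT (fun i => mu (bigcup2 A B i))).
rewrite big_ltn ?(ltnW n2)// big_ltn//= big_nat big1 ?addr0//.
by move=> [|[|i]].
Unshelve. all: by end_near. Qed.

Lemma signed_measureD (mu : set T -> R) A B : signed_measure mu ->
  measurable A -> measurable B -> mu A - mu B = mu (A `\` B) - mu (B `\` A).
Proof.
move=> smu mA mB.
have split_meas X Y : measurable X -> measurable Y ->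
    mu X = mu (X `\` Y) + mu (X `&` Y).
  move=> mX mY; rewrite -signed_measureU//.
  - by rewrite setDE setIC [X `&` Y]setIC -setIUl setUC setUv setTI.
  - exact: measurableD.
  - exact: measurableI.
  - by rewrite setDE -setIA [_ `&` (X `&` Y)]setICA setICl !setI0.
by rewrite (split_meas A B)// (split_meas B A)// [B `&` A]setIC; ring.
Qed.

Section Jordan.
Variables (m1 m2 : {measure set T -> \bar R}) (P : set T).
Hypotheses (m1T : (m1 setT < +oo)%E) (m2T : (m2 setT < +oo)%E).
Hypotheses (mP : measurable P) (m2P : m2 P = 0%E) (m1P : m1 (~` P) = 0%E).
Local Notation mu := (fun A => real_measure m1 A - real_measure m2 A).

Let null_sub (m : {measure set T -> \bar R}) A B : measurable A -> measurable B ->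
  A `<=` B -> m B = 0%E -> m A = 0%E.
Proof. by move=> mA mB AB mB0; exact: (subset_measure0 mA mB AB mB0). Qed.

(** [P] is a Hahn set: it carries [m1] and is null for [m2]. A Borel part [B] of [A] has [mu B] at
    most [m1 B], hence at most [m1 A], and the supremum is attained at the trace of [P] on [A]. *)
Lemma mu_pos_sing A : measurable A -> mu_pos mu A = m1 A.
Proof.
move=> mA; apply/eqP; rewrite eq_le; apply/andP; split.
  apply: ge_ereal_sup => _ [B [mB BA] <-].
  rewrite !real_measureE//.
  rewrite -[leRHS](fineK (finite_measure_fin_num m1T mA)) lee_fin.
  apply: (@le_trans _ _ (fine (m1 B))).
    by rewrite gerBl// fine_ge0// measure_ge0.
  apply: fine_le; [exact: finite_measure_fin_num..|].
  by apply: le_measure; rewrite ?inE.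
apply: ereal_sup_ubound; exists (A `&` P).
  by split; [exact: measurableI|exact: subIsetl].
have mAP : measurable (A `&` P) by exact: measurableI.
rewrite !real_measureE//.
rewrite (null_sub mAP mP (@subIsetr _ _ _) m2P) /= subr0 fineK; last exact: finite_measure_fin_num.
have mAD : measurable (A `\` P) by exact: measurableD.
have mAP0 : m1 (A `\` P) = 0%E.
  apply: (null_sub mAD (measurableC mP) _ m1P).
  by rewrite setDE; exact: subIsetr.
have -> : (m1 A = m1 (A `\` P) + m1 (A `&` P))%E by exact: measureDI.
by rewrite mAP0 add0e.
Qed.

End Jordan.

(** Negation exchanges [m1] and [m2], with the complement of [P] as Hahn set. *)
Lemma mu_neg_sing (m1 m2 : {measure set T -> \bar R}) (P : set T) A :
  (m1 setT < +oo)%E -> (m2 setT < +oo)%E -> measurable P ->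
  m2 P = 0%E -> m1 (~` P) = 0%E -> measurable A ->
  mu_neg (fun A => real_measure m1 A - real_measure m2 A) A = m2 A.
Proof.
move=> m1T m2T mP m2P m1P mA.
rewrite -(@mu_pos_sing m2 m1 (~` P) m2T (measurableC mP) m1P _ A mA); last by rewrite setCK.
by rewrite /mu_neg /mu_pos; congr ereal_sup; apply: eq_imagel => B _; rewrite opprB.
Qed.

Lemma Lambda_sing (f : cmap gamma k -> R) (m1 m2 : {measure set T -> \bar R}) (P : set T) :
  (m1 setT < +oo)%E -> (m2 setT < +oo)%E -> measurable P ->
  m2 P = 0%E -> m1 (~` P) = 0%E ->
  Lambda f (fun A => real_measure m1 A - real_measure m2 A) =
  fine (\int[m1]_x (f x)%:E) - fine (\int[m2]_x (f x)%:E).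
Proof.
move=> m1T m2T mP m2P m1P; rewrite /Lambda.
congr (fine _ - fine _); apply: integral_set_fun_ext => A mA.
  exact: (mu_pos_sing m1T mP m2P m1P mA).
exact: (mu_neg_sing m1T m2T mP m2P m1P mA).
Qed.

End SignedMeasures.

(** * Simplices and spaces of singular simplices *)

Section Simplices.
Variable R : realType.

Definition edge_vec (s : R) : 'rV[R]_2 := \row_j (if j == ord0 then 1 - s else s).

(** Retraction of the line onto the unit interval. Through it paths are defined and continuous on
    all of [R], which avoids subspace topologies. *)
Definition clamp (s : R) : R := Num.max 0 (Num.min 1 s).

Lemma clamp_itv s : 0 <= clamp s <= 1.
Proof. by rewrite /clamp le_max lexx /= ge_max ler01 ge_min lexx. Qed.

Lemma clampE s : 0 <= s <= 1 -> clamp s = s.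
Proof. by move=> /andP[s0 s1]; rewrite /clamp (min_idPr s1) (max_idPr s0). Qed.

Lemma is_simplex_edge_vec s : 0 <= s <= 1 -> is_simplex (edge_vec s).
Proof.
move=> /andP[s0 s1]; apply/andP; split.
  by apply/forallP => j; rewrite mxE; case: ifP; rewrite ?subr_ge0.
by rewrite big_ord_recl big_ord1 !mxE /= subrK.
Qed.

Definition edge (s : R) : simplex R 1 :=
  exist _ (edge_vec (clamp s)) (is_simplex_edge_vec (clamp_itv s)).

Lemma sval_edge s : 0 <= s <= 1 -> sval (edge s) = edge_vec s.
Proof. by move=> s01 /=; rewrite clampE. Qed.

Lemma is_simplex_vertex : is_simplex (\row_(j < 1) (1 : R)).
Proof.
by apply/andP; split; [apply/forallP => j; rewrite mxE|rewrite big_ord1 mxE].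
Qed.

Definition vertex : simplex R 0 :=
  exist (fun t : 'rV[R]_1 => is_simplex t) _ is_simplex_vertex.

Lemma simplex0E (t : simplex R 0) : t = vertex.
Proof.
apply: val_inj; apply/rowP => j; rewrite /= mxE; case: t => t /= /andP[_].
by rewrite big_ord1 (ord1 j) => /eqP.
Qed.

Lemma continuous_clamp : continuous clamp.
Proof.
move=> s; rewrite /clamp; apply: (@continuous_max R R (fun=> 0) (fun s => Num.min 1 s)).
  exact: cvg_cst.
apply: (@continuous_min R R (fun=> 1) id); [exact: cvg_cst|exact: cvg_id].
Qed.

Lemma continuous_edge_vec : continuous edge_vec.
Proof.
move=> s; apply/cvg_ballP => e e0; near=> t; split => // i j; rewrite !mxE.
have : `|s - t| < e by near: t; apply: cvgr_dist_lt => //; exact: cvg_id.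
by case: ifP => _ //= st; rewrite -ball_normE /= opprD addrACA subrr add0r opprK addrC distrC.
Unshelve. all: by end_near. Qed.

End Simplices.

(** * The compact-open topology, endpoint evaluation and convergent sequences *)

Section MappingSpaces.
Variables (R : realType) (gamma : R -> R * R).
Local Notation W := (warsaw gamma).

Lemma cmap_ext k (s s' : cmap gamma k) : (forall t, s t = s' t) -> s = s'.
Proof.
case: s s' => [f cf Wf] [g cg Wg] /= /funext fg; rewrite fg in cf Wf *.
by congr CMap; exact: Prop_irrelevance.
Qed.

Lemma cst_cont k (w : R * R) : cont_on_simplex (fun _ : simplex R k => w).
Proof.
move=> U _; have [Uw|Uw] := pselect (U w).
  by exists setT; split; [exact: openT|apply/seteqP; split].
by exists set0; split; [exact: open0|apply/seteqP; split].
Qed.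

Definition cmap_cst k (w : R * R) (Ww : W w) : cmap gamma k :=
  @CMap _ _ k (fun _ => w) (@cst_cont k w) (fun _ => Ww).

Lemma gen_open_sub T (S : set (set T)) U : S U -> gen_open S U.
Proof.
by move=> SU x Ux; exists 1%N, (fun=> U); do 2?split=> //; move=> y /(_ 0%N isT).
Qed.

Definition subbasic k (K : set 'rV[R]_k.+1) (V : set (R * R)) : set (cmap gamma k) :=
  [set s : cmap gamma k | forall t : simplex R k, K (sval t) -> (W `&` V) (s t)].

Lemma subbasic_co k K V : compact K ->
  K `<=` [set sval t | t in [set: simplex R k]] -> open V ->
  co_subbasis (subbasic (k := k) K V).
Proof. by move=> cK sK oV; exists K, V. Qed.

Lemma open_eval k (t : simplex R k) (V : set (R * R)) : open V ->
  co_subbasis [set s : cmap gamma k | V (s t)].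
Proof.
move=> oV; rewrite (_ : [set s | _] = subbasic [set sval t] V).
  apply: subbasic_co => //; first exact: compact_set1.
  by move=> _ ->; exists t.
apply/seteqP; split=> [s Vs u /= ut|s /(_ t) /= []//].
rewrite (_ : u = t); last exact: val_inj.
by split=> //; exact: cm_in.
Qed.

Definition ev (t : simplex R 1) (s : cmap gamma 1) : cmap gamma 0 :=
  cmap_cst 0 (cm_in s t).

Lemma ev_co_open t U : co_open U -> co_open (ev t @^-1` U).
Proof.
move=> oU s Us; have [n [A [SA [Ax AU]]]] := oU _ Us.
exists n, (fun i => ev t @^-1` A i); split; last first.
  by split=> [i /Ax//|y Ay]; apply: AU => i /Ay.
move=> i /SA [K [V [cK [sK [oV ->]]]]].
(* A 0-simplex has a single point, so the condition over [K] is either evaluation in [V] or void;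
   the void case is written as a subbasic set over the empty compact set. *)
have [K1|K1] := pselect (K (sval (vertex R))).
  rewrite (_ : _ @^-1` _ = [set s : cmap gamma 1 | V (s t)]); first exact: open_eval.
  apply/seteqP; split=> [x /(_ _ K1) []//|x Vx u Ku /=].
  by split => //; exact: cm_in.
rewrite (_ : _ @^-1` _ = subbasic set0 setT).
  by apply: subbasic_co => //; [exact: compact0|exact: openT].
by apply/seteqP; split=> [x _ //|x _ u /=]; rewrite (simplex0E u).
Qed.

Lemma measurable_ev t : measurable_fun setT (ev t : cmapB gamma 1 -> cmapB gamma 0).
Proof.
apply: (@measurability _ _ (cmapB gamma 1) (cmapB gamma 0) setT (ev t) (@co_open R gamma 0)) => //.
move=> _ [B oB <-]; rewrite setTI; apply: sub_sigma_algebra.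
exact: ev_co_open.
Qed.

Lemma measurable_ev_preimage t (A : set (cmapB gamma 0)) :
  measurable A -> measurable (ev t @^-1` A : set (cmapB gamma 1)).
Proof. by move=> mA; rewrite -[X in measurable X]setTI; exact: measurable_ev. Qed.

(** Face 0 is the endpoint at parameter 1 and face 1 the endpoint at parameter 0, so that the
    boundary is end minus start. *)
Lemma delta_face (i : 'I_2) (t : simplex R 0) :
  delta i (sval t) = sval (edge (i == ord0)%:R).
Proof.
rewrite (simplex0E t) sval_edge; last by case: (i == ord0); rewrite /= ?lexx ?ler01.
apply/rowP => j; rewrite !mxE.
case: unliftP => [j' ->|->]; rewrite ?mxE.
  by case: i => [[|[|]]]//= p; rewrite (ord1 j') -!val_eqE /= ?subr0.
by case: (i == ord0); rewrite ?subrr.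
Qed.

Lemma face_preimE (i : 'I_2) (A : set (cmapB gamma 0)) :
  face_preim i A = ev (edge (i == ord0)%:R) @^-1` A.
Proof.
have E s : face_fun i s = cm_fun (ev (edge (i == ord0)%:R) s).
  by apply/funext => t; rewrite /face_fun delta_face /ext_simplex valK.
apply/seteqP; split=> [s [tau [Atau]]|s As].
  rewrite E => h /=.
  by rewrite (_ : ev _ s = tau)//; apply: cmap_ext => t; rewrite h.
by exists (ev (edge (i == ord0)%:R) s); rewrite E.
Qed.

Lemma bdE (mu : set (cmapB gamma 1) -> R) A : measurable A ->
  bd mu A = mu (ev (edge 1) @^-1` A) - mu (ev (edge 0) @^-1` A).
Proof.
move=> mA; rewrite /bd asboolT// big_ord_recl big_ord1 !face_preimE /=.
by rewrite expr0 expr1 mul1r mulN1r.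
Qed.

Lemma measurable_cont k (f : cmap gamma k -> R) : cont_fun f ->
  measurable_fun setT (f : cmapB gamma k -> R).
Proof.
move=> cf mD; apply: (measurability _ (RGenOpens.measurableE R)) => //.
move=> _ [_ [a [b ->] <-]]; rewrite setTI; apply: sub_sigma_algebra.
by apply: cf; exact: interval_open.
Qed.

Lemma open_singletonC (p : cmap gamma 0) : co_open (~` [set p]).
Proof.
rewrite (_ : ~` [set p] = [set s : cmap gamma 0 | (~` [set p (vertex R)]) (s (vertex R))]).
  apply: gen_open_sub; apply: open_eval; apply: closed_openC.
  apply: accessible_closed_set1; apply: hausdorff_accessible.
  exact: norm_hausdorff.
apply/seteqP; split=> s /=; apply: contra_not => sp; last by rewrite sp.
by apply: cmap_ext => t; rewrite (simplex0E t).
Qed.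

Lemma measurable_singleton (p : cmap gamma 0) : measurable ([set p] : set (cmapB gamma 0)).
Proof.
rewrite -(setCK [set p]); apply: measurableC; apply: sub_sigma_algebra.
exact: open_singletonC.
Qed.

Definition co_cvg k (q : nat -> cmap gamma k) (l : cmap gamma k) :=
  forall U, co_open U -> U l -> \forall n \near \oo, U (q n).

Lemma co_cvg_cst (w : nat -> R * R) (Ww : forall n, W (w n)) l (Wl : W l) :
  w @ \oo --> l -> co_cvg (fun n => cmap_cst 0 (Ww n)) (cmap_cst 0 Wl).
Proof.
move=> wl U oU Ul; have [n [A [SA [Al AU]]]] := oU _ Ul.
have : \forall m \near \oo, forall i : 'I_n, A i (cmap_cst 0 (Ww m)).
  apply: filter_forall => i; have := Al i (ltn_ord i).
  have [K [V [cK [sK [oV ->]]]]] := SA i (ltn_ord i).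
  move=> Vl; have [K1|K1] := pselect (K (sval (vertex R))).
    have [_ Vl'] : (W `&` V) l := Vl _ K1.
    have : \forall m \near \oo, V (w m) by apply: wl; exact: open_nbhs_nbhs.
    by apply: filterS => m Vm t _; split=> //; exact: Ww.
  by near=> m => t; rewrite (simplex0E t).
apply: filterS => m Am; apply: AU => i ni; exact: (Am (Ordinal ni)).
Unshelve. all: by end_near. Qed.

(** The member of the cover around [l] contains all but finitely many terms. This supplies every
    compact carrier used below. *)
Lemma compact_for_cvg_seq k (q : nat -> cmap gamma k) l : co_cvg q l ->
  compact_for (@co_open R gamma k) (range q `|` [set l]).
Proof.
move=> ql F Fo cov.
have cq n : exists B, F B /\ B (q n).
  by have [|B FB Bq] := cov (q n); [left; exists n|exists B].
have [B0 FB0 B0l] : (\bigcup_(A in F) A) l by apply: cov; right.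
have [N _ NP] := ql _ (Fo _ FB0) B0l.
have [B BP] := choice cq.
exists N.+1, (fun i => if i == N then B0 else B i); split=> [i _|].
  by case: ifP => // _; have [] := BP i.
move=> _ [[n _ <-]|->]; last by exists N; rewrite /= ?eqxx.
have [nN|Nn] := ltnP n N.
  by exists n; [exact: ltnW|rewrite (ltn_eqF nN); have [] := BP n].
by exists N => /=; [exact: ltnSn|rewrite eqxx; exact: NP].
Qed.

End MappingSpaces.

(** * The oscillating tails of the sine curve *)

Section SineCurve.
Variable R : realType.

Lemma sin_periodic_nat (x : R) n : sin (x + pi *+ 2 *+ n) = sin x.
Proof.
elim: n => [|n IH]; first by rewrite mulr0n addr0.
by rewrite mulrSr addrA sinD2pi.
Qed.

(* Reciprocals of the abscissae of the minima of [sin (1/x)], from the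
   rightmost one on. *)
Definition theta (n : nat) : R := pi + pi / 2 + pi *+ 2 *+ n.

Lemma theta_gt0 n : 0 < theta n.
Proof.
have p0 := pi_gt0 R; apply: ltr_pwDl; first by rewrite addr_gt0// divr_gt0.
by rewrite mulrn_wge0// mulrn_wge0// ltW.
Qed.

Lemma thetaS n : theta n.+1 = theta n + pi *+ 2.
Proof. by rewrite /theta (mulrSr (pi *+ 2) n) addrA. Qed.

Lemma ler_theta m n : (m <= n)%N -> theta m <= theta n.
Proof. by move=> mn; rewrite /theta lerD2l ler_wpMn2l// mulrn_wge0// pi_ge0. Qed.

Lemma sin_theta n : sin (theta n) = -1.
Proof. by rewrite /theta sin_periodic_nat addrC sinDpi sin_pihalf. Qed.

Lemma sin_thetaDpi n : sin (theta n + pi) = 1.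
Proof. by rewrite sinDpi sin_theta opprK. Qed.

Lemma theta0 : (theta 0)^-1 = xmin R.
Proof.
have key (p : R) : p != 0 -> (p + p / 2)^-1 = 2 / (3 * p).
  move=> p0; have p3 : p * 2 + p != 0 by apply: contra_neq p0 => ?; lra.
  by field; rewrite p0.
by rewrite /theta mulr0n addr0 /xmin key// gt_eqF// pi_gt0.
Qed.

Lemma theta_unbounded (x : R) : exists n, x < theta n.
Proof.
exists (Num.bound `|x|); apply: (le_lt_trans (ler_norm x)).
apply: (lt_le_trans (archi_boundP (normr_ge0 x))).
have pi2 := pi_ge2 R; have p2 : 1 <= (pi : R) *+ 2 by rewrite mulr2n; lra.
rewrite /theta -[leLHS]add0r lerD//; first by rewrite addr_ge0// ?divr_ge0// pi_ge0.
by rewrite -[leRHS]mulr_natr ler_peMl// ler0n.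
Qed.

(** This is T_n above. The strict inequality leaves the minimum itself out, so that the set is
    relatively open in [W] even for [n = 0], where that minimum is an end of the closing arc. *)
Definition tail (n : nat) : set (R * R) :=
  [set p | [/\ 0 < p.1, theta n < p.1^-1 & p.2 = sin p.1^-1]].

Lemma tail_sub m n : (m <= n)%N -> tail n `<=` tail m.
Proof.
by move=> mn p [p0 np pE]; split=> //; apply: le_lt_trans np; exact: ler_theta.
Qed.

Lemma tail_ltP n p : tail n p -> 0 < p.1 < (theta n)^-1.
Proof. by move=> [p0 np _]; rewrite p0 -(invrK p.1) ltf_pV2// posrE ?invr_gt0// theta_gt0. Qed.

Lemma tail_sine n : tail n `<=` @sine_part R.
Proof.
move=> [x y] /[dup] /tail_ltP /andP[_ xn] [/= x0 _ ->]; exists x; split=> //.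
rewrite x0 /= -theta0 (le_trans (ltW xn))// lef_pV2 ?posrE ?theta_gt0//.
exact: ler_theta.
Qed.

Definition curve (x : R) : R * R := (x, sin x^-1).

Lemma continuous_curve x : x != 0 -> {for x, continuous curve}.
Proof.
move=> x0; have sx : sin u^-1 @[u --> x] --> sin x^-1.
  by apply: continuous_comp; [exact: inv_continuous|exact: continuous_sin].
exact: (cvg_pair cvg_id sx).
Qed.

Variable gamma : R -> R * R.
Hypothesis arc : warsaw_arc gamma.
Local Notation W := (warsaw gamma).

Lemma closed_vert_segment : closed (@vert_segment R).
Proof.
rewrite (_ : @vert_segment R = fst @^-1` [set 0] `&` snd @^-1` `[-1, 1]); last first.
  by apply/seteqP; split => p /=; rewrite /vert_segment /= in_itv.
apply: closedI.
  by apply: (closed_comp (f := fst)) => [p _|]; [exact: cvg_fst|exact: closed_eq].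
by apply: (closed_comp (f := snd)) => [p _|]; [exact: cvg_snd|exact: itv_closed].
Qed.

Lemma closed_arc : closed (gamma @` `[0, 1]).
Proof.
apply: compact_closed; first exact: norm_hausdorff.
by apply: continuous_compact; [case: arc|exact: segment_compact].
Qed.

Lemma closed_curve (a b : R) : 0 < a -> closed (curve @` `[a, b]).
Proof.
move=> a0; apply: compact_closed; first exact: norm_hausdorff.
apply: continuous_compact; last exact: segment_compact.
apply: continuous_in_subspaceT => x; rewrite inE /= in_itv /= => /andP[ax _].
by apply: continuous_curve; rewrite gt_eqF// (lt_le_trans a0).
Qed.

(* Disjointness of the closing arc from the sine curve enters here. *)
Lemma tail_relatively_open n : exists V, open V /\ forall p, W p -> V p <-> tail n p.
Proof.
(* [F] is closed, misses [tail n] and covers the rest of [W]. *)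
pose F := @vert_segment R `|` gamma @` `[0, 1] `|` curve @` `[(theta n)^-1, xmin R].
have cF : closed F.
  apply: closedU; last by apply: closed_curve; rewrite invr_gt0 theta_gt0.
  by apply: closedU; [exact: closed_vert_segment|exact: closed_arc].
exists (~` F); split; first exact: closed_openC.
move=> p Wp; split=> [nF|tp].
  move: Wp nF => [[[x [/andP[x0 xm] ->]]|vp]|gp] nF; last 2 first.
  - by exfalso; apply: nF; left; left.
  - by exfalso; apply: nF; left; right.
  split=> //=; rewrite ltNge; apply/negP => xn; apply: nF; right.
  exists x => //=; rewrite in_itv /= xm andbT -(invrK x) lef_pV2 ?posrE ?invr_gt0//.
  exact: theta_gt0.
have /andP[p0 pn] := tail_ltP tp.
move=> [[[p0' _]|[s]]|[x /=]].
- by rewrite p0' ltxx in p0.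
- rewrite /= in_itv /= => /andP[s0 s1] gs.
  (* Interior points of the arc are off the sine curve by hypothesis; its ends have abscissae 0 and
     [xmin], which no point of [tail n] has. *)
  have [_ [_ [g0 [g1 gd]]]] := arc.
  move: s0; rewrite le_eqVlt => /orP[/eqP s0|s0].
    by move: p0; rewrite -gs -s0 g0 /= ltxx.
  move: s1; rewrite le_eqVlt => /orP[/eqP s1|s1].
    move: pn; rewrite -gs s1 g1 /= -theta0 ltNge lef_pV2 ?posrE ?theta_gt0//.
    by rewrite ler_theta.
  have [|ns _] := gd s; first by rewrite s0.
  by apply: ns; rewrite gs; exact: tail_sine tp.
- by rewrite in_itv /= => /andP[nx _] xp; move: pn; rewrite -xp /= ltNge nx.
Qed.

(** Up to the first exit time from [tail n] the path follows the sine curve, and its abscissa takes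
    all intermediate values. Leaving on either side would force a visit to both a minimum and a
    maximum, against the bound 2 on the variation of height. *)
Lemma path_step (phi : R -> R * R) (a b : R) n : a <= b -> continuous phi ->
  (forall t, W (phi t)) ->
  (forall s t, a <= s <= b -> a <= t <= b -> `|(phi s).2 - (phi t).2| < 2) ->
  tail n.+1 (phi a) -> tail n (phi b).
Proof.
move=> ab cphi Wphi osc ta; apply: contrapT => ntb.
have [V [oV VP]] := tail_relatively_open n.
(* The times spent outside [tail n] form a compact set; its least element [tau] is the first exit
   time. *)
pose T := `[a, b] `&` phi @^-1` ~` V.
have Tb : T b.
  by split=> [|Vb]; [rewrite /= in_itv /= ab lexx|apply: ntb; exact/VP].
have cT : compact T.
  apply: compact_closedI; first exact: segment_compact.
  by apply: closed_comp => [t _|]; [exact: cphi|exact: open_closedC].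
have T0 : T !=set0 by exists b.
have cid : {within T, continuous (@idfun R)}.
  by apply: continuous_subspaceT => x; exact: cvg_id.
have [tau [/= tau_ab nVtau] tau_min] : exists2 tau : R, T tau & forall t, T t -> tau <= t.
  have [tau /set_mem Ttau tau_min] := compact_EVT_min T0 cT cid.
  by exists tau => // t Tt; apply: tau_min; rewrite inE.
move: tau_ab; rewrite in_itv /= => /andP[atau taub].
have before t : a <= t < tau -> tail n (phi t).
  move=> /andP[at_ ttau]; apply/VP => //; apply: contrapT => nVt.
  have := tau_min t; rewrite leNgt ttau => /(_ _)/negP; case=> //.
  by split=> //; rewrite /= in_itv /= at_ ltW// (lt_le_trans ttau).
have {}atau : a < tau.
  rewrite lt_neqAle atau andbT; apply/eqP => E; apply: nVtau; apply/VP => //.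
  by rewrite -E; apply: tail_sub ta.
pose x t := (phi t).1.
have cx : continuous x by move=> t; apply: continuous_comp; [exact: cphi|exact: cvg_fst].
have xbefore t : a <= t < tau -> 0 < x t < (theta n)^-1.
  by move=> /before /tail_ltP.
have near_before : \forall t \near tau^'-, a <= t < tau.
  near=> t; apply/andP; split; last by near: t; exact: nbhs_left_lt.
  by apply: ltW; near: t; exact: nbhs_left_gt.
have xlim : x t @[t --> tau^'-] --> x tau by apply: cvg_at_left_filter; exact: cx.
have xtau_ge0 : 0 <= x tau.
  apply: (@closed_cvg _ _ (tau^'-) _ x (fun v : R => 0 <= v) (@closed_ge R 0) _ (x tau) xlim).
  by apply: filterS near_before => t /xbefore /andP[/ltW].
have xtau_le : x tau <= (theta n)^-1.
  apply: (@closed_cvg _ _ (tau^'-) _ x (fun v : R => v <= (theta n)^-1)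
    (@closed_le R _) _ (x tau) xlim).
  by apply: filterS near_before => t /xbefore /andP[_ /ltW].
have cross v : Num.min (x a) (x tau) < v < Num.max (x a) (x tau) ->
    exists2 t, a <= t <= b & (phi t).2 = sin v^-1.
  move=> /andP[v1 v2].
  have [||t tI xt] := @IVT _ x a tau v (ltW atau).
  - by apply: continuous_subspaceT.
  - by rewrite !ltW.
  move: tI; rewrite in_itv /= => /andP[at_ ttau].
  have ttau' : t < tau.
    rewrite lt_neqAle ttau andbT; apply/eqP => E.
    move: v1 v2; rewrite -xt E gt_min lt_max !ltxx !orbF => h /(lt_trans h).
    by rewrite ltxx.
  exists t; first by rewrite at_ (le_trans ttau).
  by have [_ _ ->] := before t (introT andP (conj at_ ttau')); rewrite -/(x t) xt.
(* The heights at these two abscissae are -1 and 1, exactly 2 apart. *)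
have no_cross k l : Num.min (x a) (x tau) < (theta k)^-1 < Num.max (x a) (x tau) ->
    Num.min (x a) (x tau) < (theta l + pi)^-1 < Num.max (x a) (x tau) -> False.
  move=> /cross[s sI sE] /cross[t tI tE].
  have := osc s t sI tI; rewrite sE tE !invrK sin_theta sin_thetaDpi.
  by rewrite -opprD normrN ger0_norm ?ler0n// -[1 + 1]/(2%:R) ltxx.
have /andP[xa0 xan] := tail_ltP ta.
have p0 := pi_gt0 R.
have tp l : 0 < theta l + pi by rewrite addr_gt0// theta_gt0.
have V2 l : (theta l + pi)^-1 < (theta l)^-1.
  by rewrite ltf_pV2 ?posrE ?tp ?theta_gt0 ?ltrDl.
have V1 l : (theta l.+1)^-1 < (theta l + pi)^-1.
  by rewrite ltf_pV2 ?posrE ?tp ?theta_gt0// thetaS mulr2n ltrD2l ltrDl.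
move: xtau_le; rewrite le_eqVlt => /orP[/eqP xtauE|xtau_lt].
  (* Exit to the right: the path starts left of minimum [n.+1] and reaches minimum [n], so it passes
     minimum [n.+1] and the maximum in between. *)
  apply: (no_cross n.+1 n); rewrite ?gt_min ?lt_max ?xtauE.
    by rewrite xan/= (lt_trans (V1 n) (V2 n)) orbT.
  by rewrite V2 orbT (lt_trans xan).
move: xtau_ge0; rewrite le_eqVlt => /orP[/eqP xtauE|xtau_gt].
  (* Exit to the limit segment: every minimum far enough to the left is crossed, and so is the
     maximum next to it. *)
  have [k kP] := theta_unbounded (x a)^-1.
  have xk : (theta k)^-1 < x a.
    by rewrite -(invrK (x a)) ltf_pV2// posrE ?invr_gt0// theta_gt0.
  apply: (no_cross k k); rewrite ?gt_min ?lt_max -?xtauE.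
    by rewrite xk invr_gt0 theta_gt0 orbT.
  by rewrite (lt_trans (V2 k) xk) invr_gt0 addr_gt0 ?theta_gt0// orbT.
(* The abscissa at [tau] is now strictly inside the range of [tail n]. There [h], the height above
   the sine curve, is continuous and vanishes before [tau], so [phi tau] is still in [tail n]. *)
apply: nVtau; apply/VP => //; split => //.
  by rewrite -(invrK (theta n)) ltf_pV2// posrE invr_gt0 theta_gt0.
pose h t := (phi t).2 - sin (x t)^-1.
have ch : {for tau, continuous h}.
  apply: cvgB.
    by apply: continuous_comp; [exact: cphi|exact: cvg_snd].
  apply: continuous_comp; last exact: continuous_sin.
  by apply: continuous_comp; [exact: cx|apply: inv_continuous; rewrite gt_eqF].
have h0 : h t @[t --> tau^'-] --> 0.
  apply: cvg_near_cst; apply: filterS near_before => t /before [_ _ tE].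
  by rewrite /h tE subrr.
have := cvg_at_left_filter ch => /(cvg_unique _ h0).
by move=> /(_ (@norm_hausdorff _ _))/esym/eqP; rewrite subr_eq0 => /eqP.
Unshelve. all: by end_near. Qed.
End SineCurve.

Arguments theta {R}.
Arguments tail {R}.
Arguments curve {R}.

(** * Crossing bounds for compact families of paths *)

Section TailCrossings.
Variables (R : realType) (gamma : R -> R * R).
Hypothesis arc : warsaw_arc gamma.
Local Notation W := (warsaw gamma).

(** By [path_step], each of the [N] pieces costs at most one index. *)
Lemma path_tail (phi : R -> R * R) (N n : nat) : continuous phi ->
  (forall t, W (phi t)) ->
  (forall i, (i < N)%N -> forall s t,
    i%:R / N%:R <= s <= i.+1%:R / N%:R -> i%:R / N%:R <= t <= i.+1%:R / N%:R ->
    `|(phi s).2 - (phi t).2| < 2) ->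
  (0 < N)%N -> tail (n + N) (phi 0) -> tail n (phi 1).
Proof.
move=> cphi Wphi osc N0 t0.
suff H i : (i <= N)%N -> tail (n + (N - i)) (phi (i%:R / N%:R)).
  by have := H N (leqnn N); rewrite subnn addn0 divff// pnatr_eq0 -lt0n.
elim: i => [_|i IH iN]; first by rewrite mul0r subn0.
apply: (path_step arc _ cphi Wphi (osc i iN)).
  by rewrite ler_wpM2r ?invr_ge0// ler_nat.
by have := IH (ltnW iN); rewrite subnS -addnS prednK// subn_gt0.
Qed.

(** Heine-Cantor, with the modulus in the form [1/N] so that [N] can be the number of pieces in
    [path_tail]. *)
Lemma unif_continuous_unit_itv (f : R -> R) (e : R) : continuous f -> 0 < e ->
  exists2 N, (0 < N)%N & forall s t, 0 <= s <= 1 -> `|s - t| <= N%:R^-1 -> `|f s - f t| < e.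
Proof.
move=> cf e0.
have /compact_near_coveringP cov := @segment_compact R 0 1.
have [|N _ NP] := cov nat \oo (fun N s => forall t, `|s - t| <= N.+1%:R^-1 -> `|f s - f t| < e) _.
  move=> x _.
  have e2 : 0 < e / 2 by rewrite divr_gt0.
  have /cvgrPdist_lt /(_ _ e2) /nbhs_ballP [d /= d0 dP] := cf x.
  have d2 : 0 < d / 2 by rewrite divr_gt0.
  exists (ball x (d / 2), [set N | N.+1%:R^-1 < d / 2]).
    split; first exact: nbhsx_ballx.
    have := near_infty_natSinv_lt (PosNum d2).
    by apply: filterS.
  move=> [s N] [/= xs Nd] t st.
  rewrite -(subrKA (f x)) (le_lt_trans (ler_normD _ _))// (splitr e) ltrD//.
    rewrite distrC; apply: dP; rewrite -ball_normE /= in xs *.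
    by rewrite (lt_trans xs)// ltr_pdivrMr// ltr_pMr// ltr1n.
  apply: dP; rewrite -ball_normE /= in xs *.
  rewrite -(subrKA s) (le_lt_trans (ler_normD _ _))// (splitr d) ltrD//.
  exact: le_lt_trans Nd.
exists N.+1 => // s t s01; apply: (NP N (leqnn N) s).
by rewrite /= in_itv.
Qed.

Definition trace (s : cmap gamma 1) (t : R) : R * R := s (edge t).

Lemma continuous_trace s : continuous (trace s).
Proof.
apply/continuousP => U oU; have [V [oV UV]] := cm_cont s oU.
rewrite (_ : _ @^-1` _ = (@edge_vec R \o @clamp R) @^-1` V).
  apply: open_comp oV => x _; apply: continuous_comp.
    exact: continuous_clamp.
  exact: continuous_edge_vec.
by apply/seteqP; split=> x /=; rewrite -[_ (edge_vec _)]/((sval @^-1` V) (edge x)) -UV.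
Qed.

(** Uniform continuity of the height of [s] gives [N]. The paths in [U] stay, on each of the [N]
    pieces, within height 1 of the value of [s] at its left end, so they all vary by less than 2
    there and [path_tail] applies to them with the same [N]. *)
Lemma local_tail_bound (s : cmap gamma 1) : exists U N, [/\ co_open U, U s &
  forall s', U s' -> forall n,
    (tail (n + N) (trace s' 0) -> tail n (trace s' 1)) /\
    (tail (n + N) (trace s' 1) -> tail n (trace s' 0))].
Proof.
have cy : continuous (fun t => (trace s t).2).
  by move=> t; apply: continuous_comp; [exact: continuous_trace|exact: cvg_snd].
have [N N0 NP] := unif_continuous_unit_itv cy ltr01.
have N0' : 0 < N%:R :> R by rewrite ltr0n.
pose I i : set R := `[i%:R / N%:R, i.+1%:R / N%:R]%classic.
pose V i : set (R * R) := snd @^-1` ball (trace s (i%:R / N%:R)).2 1.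
pose U : set (cmap gamma 1) :=
  [set s' | forall i, (i < N)%N -> subbasic (@edge_vec R @` I i) (V i) s'].
have I01 i t : (i < N)%N -> I i t -> 0 <= t <= 1.
  move=> iN; rewrite /I /= in_itv /= => /andP[t1 t2]; apply/andP; split.
    by rewrite (le_trans _ t1)// divr_ge0.
  by rewrite (le_trans t2)// ler_pdivrMr// mul1r ler_nat.
have UP s' : U s' <-> forall i t, (i < N)%N -> I i t -> V i (trace s' t).
  split=> [Us' i t iN It|h i iN u /= [t It tu]].
    have [] // : (W `&` V i) (s' (edge t)); apply: (Us' i iN) => /=.
    by exists t => //; rewrite clampE// (I01 i).
  split; first exact: cm_in.
  have -> : u = edge t by apply: val_inj; rewrite /= -tu clampE// (I01 i).
  exact: h.
have osc s' : U s' -> forall i, (i < N)%N -> forall x y,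
    i%:R / N%:R <= x <= i.+1%:R / N%:R -> i%:R / N%:R <= y <= i.+1%:R / N%:R ->
    `|(trace s' x).2 - (trace s' y).2| < 2.
  move=> /UP h i iN x y xI yI.
  have := h i x iN; rewrite /I /= in_itv /= xI => /(_ isT).
  have := h i y iN; rewrite /I /= in_itv /= yI => /(_ isT).
  rewrite /V /= -!ball_normE /= => hy hx.
  rewrite -(subrKA (trace s (i%:R / N%:R)).2) (le_lt_trans (ler_normD _ _))//.
  by rewrite -[2%:R]/(1 + 1) ltrD// distrC.
exists U, N; split.
- move=> x Ux; exists N, (fun i => subbasic (@edge_vec R @` I i) (V i)); split; last by [].
  move=> i iN; apply: subbasic_co.
  + apply: continuous_compact; last exact: segment_compact.
    by apply: continuous_subspaceT; exact: continuous_edge_vec.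
  + by move=> _ [t It <-]; exists (edge t) => //; rewrite sval_edge// (I01 i).
  + by apply: open_comp => [p _|]; [exact: cvg_snd|exact: ball_open].
- apply/UP => i t iN It; rewrite /V /= -ball_normE /=; apply: NP.
    by apply: (I01 i) => //; rewrite /I /= in_itv /= lexx ler_pM2r ?invr_gt0// ler_nat leqnSn.
  move: It; rewrite /I /= in_itv /= => /andP[t1 t2].
  rewrite distrC ger0_norm ?subr_ge0// lerBlDl (le_trans t2)//.
  by rewrite -natr1 mulrDl mul1r.
- move=> s' Us' n; split.
    apply: path_tail => //; [exact: continuous_trace| |exact: osc].
    by move=> t; exact: cm_in.
  (* The second implication is the first one for the reversed path; reversal sends piece [i] to
     piece [N - i.+1]. *)
  have -> : trace s' 1 = (trace s' \o (fun t => 1 - t)) 0 by rewrite /= subr0.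
  have -> : trace s' 0 = (trace s' \o (fun t => 1 - t)) 1 by rewrite /= subrr.
  apply: path_tail => //.
  + move=> t; apply: continuous_comp; last exact: continuous_trace.
    by apply: cvgB; [exact: cvg_cst|exact: cvg_id].
  + by move=> t; exact: cm_in.
  + have flip i : (i < N)%N -> forall t : R, i%:R / N%:R <= t <= i.+1%:R / N%:R ->
        (N - i.+1)%:R / N%:R <= 1 - t <= (N - i.+1).+1%:R / N%:R.
      move=> iN t /andP[t1 t2].
      have E k : (k <= N)%N -> (N - k)%:R / N%:R = 1 - k%:R / N%:R :> R.
        by move=> kN; rewrite natrB// mulrBl divff// gt_eqF.
      rewrite -subSn// subSS !E ?(ltnW iN)//.
      by rewrite !lerD2l !lerN2 t1 t2.
    move=> i iN x y /(flip i iN) xI /(flip i iN) yI; apply: (osc s' Us' _ _ _ _ xI yI).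
    by rewrite ltn_subrL N0.
Qed.

(** The tails are nested, so a local bound may be enlarged, and the maximum over a finite subcover
    serves all of [K]. *)
Lemma compact_tail_bound (K : set (cmap gamma 1)) : compact_for (@co_open R gamma 1) K ->
  exists N, forall s, K s -> forall n,
    (tail (n + N) (trace s 0) -> tail n (trace s 1)) /\
    (tail (n + N) (trace s 1) -> tail n (trace s 0)).
Proof.
move=> cK.
pose good N s := forall n, (tail (n + N) (trace s 0) -> tail n (trace s 1)) /\
    (tail (n + N) (trace s 1) -> tail n (trace s 0)).
have goodS M N s : (M <= N)%N -> good M s -> good N s.
  move=> MN h n; have [h1 h2] := h n.
  by split=> t; [apply: h1|apply: h2]; apply: tail_sub t; rewrite leq_add2l.
pose F := [set U : set (cmap gamma 1) | co_open U /\ exists N, forall s, U s -> good N s].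
have [||n [A [FA KA]]] := cK F.
- by move=> U [].
- move=> s _; have [U [N [oU Us UN]]] := local_tail_bound s.
  by exists U => //; split=> //; exists N.
have /choice[M MP] : forall i, exists N, (i < n)%N -> forall s, A i s -> good N s.
  move=> i; have [ni|ni] := ltnP i n; last by exists 0%N.
  by have [_ [N NP]] := FA i ni; exists N.
exists (\max_(i < n) M i)%N => s /KA [i /= ni Ais].
by apply: goodS (MP i ni s Ais); exact: (leq_bigmax (Ordinal ni)).
Qed.

End TailCrossings.

(** * Chains and boundaries *)

Section Chains.
Variables (R : realType) (gamma : R -> R * R).
Local Notation chain k := (set (cmapB gamma k) -> R).

Lemma compact_forU T (O : set (set T)) K L :
  compact_for O K -> compact_for O L -> compact_for O (K `|` L).
Proof.
move=> cK cL F FO KL.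
have [n [A [FA KA]]] := cK F FO (subset_trans (@subsetUl _ K L) KL).
have [m [B [FB LB]]] := cL F FO (subset_trans (@subsetUr _ K L) KL).
exists (n + m)%N, (fun i => if (i < n)%N then A i else B (i - n)%N); split=> [i im|].
  by case: ltnP => ni; [exact: FA|apply: FB; rewrite ltn_subLR].
move=> x [/KA [i /= ni Ax]|/LB [i /= mi Bx]].
  by exists i => /=; rewrite ?ni// ltn_addr.
by exists (n + i)%N => /=; rewrite ?ltn_add2l// ltnNge leq_addr /= addKn.
Qed.

Lemma chainsB k (mu nu : chain k) :
  chains mu -> chains nu -> chains (fun A => mu A - nu A).
Proof.
move=> [smu [K [cK muK]]] [snu [L [cL nuL]]]; split; first exact: signed_measureB.
exists (K `|` L); split=> [|A mA]; first exact: compact_forU.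
rewrite setIUr setU_eq0 => -[AK AL].
by rewrite muK// nuL// subr0.
Qed.

Lemma boundariesB k (b c : chain k) :
  boundaries b -> boundaries c -> boundaries (fun A => b A - c A).
Proof.
move=> [mu cmu <-] [nu cnu <-]; exists (fun A => mu A - nu A); first exact: chainsB.
apply/funext => A; rewrite /bd; case: ifP => _; last by rewrite subrr.
by rewrite -sumrB; apply: eq_bigr => i _; rewrite mulrBr.
Qed.

Lemma coset0_boundary (b : chain 0) : boundaries b -> coset0 b = coset0 (fun=> 0).
Proof.
move=> bb.
have b0 : boundaries ((fun=> 0) : chain 0).
  have <- : (fun A => b A - b A) = (fun=> 0) by apply/funext => A; rewrite subrr.
  exact: boundariesB.
apply/seteqP; split=> nu [c [bc ->]].
  exists (fun A => b A - (0 - c A)); split.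
    by apply: boundariesB => //; exact: boundariesB.
  by apply/funext => A; rewrite sub0r opprK add0r.
exists (fun A => c A - b A); split; first exact: boundariesB.
by apply/funext => A; rewrite add0r addrC subrK.
Qed.

(* If the carrier of [mu] meets [E i.+1] only inside [E' i], the differences
   [E i `\` E' i] are disjoint up to null sets, so countable additivity applies. *)
Lemma cvg_sum_difference (mu : chain 1) (K : set (cmapB gamma 1))
    (E E' : nat -> set (cmapB gamma 1)) : signed_measure mu ->
  (forall A, measurable A -> A `&` K = set0 -> mu A = 0) ->
  (forall i, measurable (E i)) -> (forall i, measurable (E' i)) ->
  (forall i, E i.+1 `<=` E i) -> (forall i, E i.+1 `&` K `<=` E' i) ->
  cvgn (fun n => \sum_(i < n) mu (E i `\` E' i)).
Proof.
move=> smu muK mE mE' dE EK.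
pose D i := (E i `\` E i.+1) `\` E' i.
have mD i : measurable (D i) by do 2?apply: measurableD.
have muD i : mu (E i `\` E' i) = mu (D i).
  have -> : E i `\` E' i = D i `|` (E i.+1 `\` E' i).
    apply/seteqP; split=> x.
      by move=> [Ex E'x]; have [?|?] := pselect (E i.+1 x); [right|left].
    by move=> [[[]]//|[/dE]].
  rewrite (signed_measureU smu) //; last 2 first.
  - exact: measurableD.
  - by apply/seteqP; split=> x //= [[[_ nE] _] []].
  rewrite (muK (E i.+1 `\` E' i) (measurableD (mE _) (mE' _))) ?addr0//.
  by apply/seteqP; split=> x //= [[Ex nE'x] Kx]; apply: nE'x; exact: EK.
have dEn i j : (i <= j)%N -> E j `<=` E i.
  by move=> /subnKC <-; elim: (j - i)%N => [|k IH]; rewrite ?addn0// addnS => x /dE /IH.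
have tD : trivIset setT D.
  apply/trivIsetP => i j _ _.
  wlog ij : i j / (i < j)%N.
    move=> H; rewrite neq_ltn => /orP[ij|ji]; first by apply: H => //; rewrite ltn_eqF.
    by rewrite setIC; apply: H => //; rewrite ltn_eqF.
  by move=> _; apply/seteqP; split=> x //= [[[_ nE] _] [[Ej _] _]]; apply: nE; exact: dEn Ej.
under eq_fun do under eq_bigr do rewrite muD.
have [_ [_ /(_ D mD tD) h]] := smu.
by apply/cvg_ex; exists (mu (\bigcup_n D n)).
Qed.

End Chains.

(** * The class that cannot be separated from zero *)

Section Witness.
Variables (R : realType) (gamma : R -> R * R).
Local Notation W := (warsaw gamma).

(* Zeros of [sin (1/x)], one between any two consecutive minima. *)
Definition absc (n : nat) : R := (pi *+ 2 *+ n.+1)^-1.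

Lemma absc_gt0 n : 0 < absc n.
Proof. by rewrite invr_gt0 pmulrn_lgt0// pmulrn_lgt0// pi_gt0. Qed.

Lemma curve_absc n : curve (absc n) = (absc n, 0).
Proof. by rewrite /curve invrK -[_ *+ n.+1]add0r sin_periodic_nat sin0. Qed.

(** The reciprocal of [absc n] is [theta n] plus a quarter period, hence below [theta n.+1]. *)
Lemma tail_absc m n : tail m (curve (absc n)) <-> (m <= n)%N.
Proof.
have pE (p : R) (k : nat) : p *+ 2 *+ k = 2 * k%:R * p.
  by rewrite -mulr_natl -[p *+ 2]mulr_natl; ring.
have nE : n.+1%:R = n%:R + 1 :> R by rewrite natr1.
have lt_theta : theta m < (absc n)^-1 <-> (m <= n)%N.
  rewrite invrK /theta !pE nE; move: (pi_gt0 R); move: (pi : R) => p p0.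
  split=> [|mn].
    rewrite leqNgt => h; apply/negP => nm.
    have : n%:R + 1 <= m%:R :> R by rewrite natr1 ler_nat.
    by rewrite -(ler_pM2r p0) => h1; lra.
  have : m%:R <= n%:R :> R by rewrite ler_nat.
  by rewrite -(ler_pM2r p0) => h1; lra.
by split=> [[_ /lt_theta]|/lt_theta]; last by split=> //; exact: absc_gt0.
Qed.

Lemma absc_le n : absc n <= xmin R.
Proof.
have /tail_absc/tail_ltP /= := leq0n n.
by rewrite theta0 => /andP[_ /ltW].
Qed.

Lemma warsaw_curve x : 0 < x <= xmin R -> W (curve x).
Proof. by move=> h; left; left; exists x. Qed.

Lemma warsaw_absc n : W (curve (absc n)).
Proof. by apply: warsaw_curve; rewrite absc_gt0 absc_le. Qed.

Definition pt n : cmap gamma 0 := cmap_cst 0 (warsaw_absc n).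

Lemma cvg_absc : curve \o absc @ \oo --> ((0, 0) : R * R).
Proof.
have a0 : absc n @[n --> \oo] --> (0 : R).
  have -> : absc = (fun n => (pi *+ 2)^-1 * n.+1%:R^-1) :> (nat -> R).
    by apply/funext => n; rewrite /absc -[_ *+ n.+1]mulr_natr invfM.
  rewrite -[X in _ --> X](mulr0 (pi *+ 2)^-1).
  by apply: cvgMr; exact: cvg_harmonic.
have -> : curve \o absc = (fun n => (absc n, 0)) :> (nat -> R * R).
  by apply/funext => n; rewrite /= curve_absc.
exact: (cvg_pair a0 (cvg_cst 0)).
Qed.

Definition limit_pt : cmap gamma 0 := cmap_cst 0 (@origin_in_warsaw R gamma).

Lemma co_cvg_pt : co_cvg pt limit_pt.
Proof. exact: co_cvg_cst cvg_absc. Qed.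

Lemma pt_inj m n : pt m = pt n -> m = n.
Proof.
move=> /(congr1 (fun s : cmap gamma 0 => s (vertex R))) /= E.
apply/eqP; rewrite eqn_leq; apply/andP; split; apply/tail_absc.
  by rewrite -E; apply/tail_absc.
by rewrite E; apply/tail_absc.
Qed.

Section CurveArc.
Variables u v : R.
Hypotheses (u0 : 0 < u <= xmin R) (v0 : 0 < v <= xmin R).

(** The abscissa moves linearly from [u] to [v]. Because of [clamp] it stays positive on the whole
    ambient space of row vectors, where [curve] composed with [g] is then continuous. *)
Let g (r : 'rV[R]_2) : R := u + clamp (r ord0 ord_max) * (v - u).

Let g_itv r : 0 < g r <= xmin R.
Proof.
rewrite /g; have := clamp_itv (r ord0 ord_max).
move: (clamp _) => c /andP[c0 c1]; case/andP: u0 => u1 u2; case/andP: v0 => v1 v2.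
have -> : u + c * (v - u) = (1 - c) * u + c * v by ring.
apply/andP; split; last by nra.
have [->|cn0] := eqVneq c 0; first by rewrite subr0 mul1r mul0r addr0.
by rewrite ltr_wpDl ?mulr_ge0 ?subr_ge0 ?(ltW u1)// mulr_gt0// lt0r cn0.
Qed.

Lemma curve_arc_cont : cont_on_simplex (fun t : simplex R 1 => curve (g (sval t))).
Proof.
move=> U oU; exists ((curve \o g) @^-1` U); split=> //.
have cc (r : 'rV[R]_2) : clamp (s ord0 ord_max) @[s --> r] --> clamp (r ord0 ord_max).
  apply: (@continuous_comp _ _ _ (fun s : 'rV[R]_2 => s ord0 ord_max) (@clamp R)).
    exact: coord_continuous.
  exact: continuous_clamp.
apply: open_comp oU => r _; apply: continuous_comp.
  exact: (cvgD (cvg_cst u) (cvgM (cc r) (cvg_cst (v - u)))).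
by apply: continuous_curve; rewrite gt_eqF//; have /andP[] := g_itv r.
Qed.

Definition curve_arc : cmap gamma 1 :=
  CMap curve_arc_cont (fun t => warsaw_curve (g_itv (sval t))).

Lemma curve_arc0 : curve_arc (edge 0) = curve u.
Proof.
have c0 : clamp (0 : R) = 0 by rewrite clampE// lexx ler01.
by rewrite /= /g mxE /= !c0 mul0r addr0.
Qed.

Lemma curve_arc1 : curve_arc (edge 1) = curve v.
Proof.
have c1 : clamp (1 : R) = 1 by rewrite clampE// lexx ler01.
by rewrite /= /g mxE /= !c1 mul1r addrC subrK.
Qed.

End CurveArc.

End Witness.

(** * Summable weights with slowly decaying remainders *)

Section Weights.
Variable R : realType.

Lemma weight_ge0 n : 0 <= (n.+1%:R * n.+2%:R)^-1 :> R.
Proof. by rewrite invr_ge0 mulr_ge0. Qed.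

(** The total is finite, yet the remainder from index [m] on is [1/(m+1)], whose sum diverges along
    every arithmetic progression. *)
Definition weight (n : nat) : {nonneg R} := NngNum (weight_ge0 n).

Lemma weightE n : (weight n)%:num = n.+1%:R^-1 - n.+2%:R^-1 :> R.
Proof.
have n1 : n.+1%:R != 0 :> R by rewrite pnatr_eq0.
have n2 : n.+2%:R != 0 :> R by rewrite pnatr_eq0.
rewrite /=; have E : n.+2%:R = n.+1%:R + 1 :> R by rewrite natr1.
move: n1 n2; rewrite E; move: (n.+1%:R : R) => x x0 x1.
by field; rewrite x0 x1.
Qed.

(** The sum telescopes by [weightE]. The condition [m <= n] is a factor so that it can match the
    indicator of a tail. *)
Lemma sum_weight_ge m j :
  \sum_(n < m + j) (weight n)%:num * (m <= n)%N%:R = m.+1%:R^-1 - (m + j).+1%:R^-1 :> R.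
Proof.
elim: j => [|j IH].
  by rewrite addn0 subrr big1// => i _; rewrite leqNgt ltn_ord mulr0.
by rewrite addnS big_ord_recr IH leq_addr mulr1 weightE /= addrA subrK.
Qed.

Lemma sum_weight_fin : (\sum_(0 <= n <oo) (weight n)%:num%:E < +oo :> \bar R)%E.
Proof.
apply: (@le_lt_trans _ _ 1%E); last exact: ltry.
apply: lime_le; first by apply: is_cvg_nneseries => n _ _; rewrite lee_fin.
near=> N; rewrite sumEFin lee_fin big_mkord.
have := sum_weight_ge 0 N; rewrite add0n.
under eq_bigr do rewrite leq0n mulr1.
by move=> ->; rewrite invr1 gerBl.
Unshelve. all: by end_near. Qed.

End Weights.

(** * The witness, its approximation by boundaries, and why it is no boundary *)

Section NonHausdorff.
Variables (R : realType) (gamma : R -> R * R).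
Hypothesis arc : warsaw_arc gamma.
Local Notation b := (@weight R).
Local Notation pt := (pt gamma).
Local Notation bfin := (sum_weight_fin R).

(** The shift keeps the base point out of the sequence, so the two measures in [z] are mutually
    singular. *)
Definition far_pt (n : nat) : cmapB gamma 0 := pt n.+1.
Definition base_pt (n : nat) : cmapB gamma 0 := pt 0.

Definition z : set (cmapB gamma 0) -> R :=
  fun A => real_measure (atoms b far_pt) A - real_measure (atoms b base_pt) A.

Definition ztrunc (N : nat) : set (cmapB gamma 0) -> R :=
  fun A => real_measure (atoms_upto b far_pt N) A - real_measure (atoms_upto b base_pt N) A.

Let finT k (q : nat -> cmapB gamma k) : (atoms b q setT < +oo)%E.
Proof. by apply: atoms_finite => //; exact: sum_weight_fin. Qed.

Let finT_upto k (q : nat -> cmapB gamma k) N : (atoms_upto b q N setT < +oo)%E.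
Proof. by rewrite atoms_uptoE ltry. Qed.

Let carrier : set (cmapB gamma 0) := range pt `|` [set limit_pt gamma].

Let carrier_far A : A `&` carrier = set0 -> forall n, ~ A (far_pt n).
Proof.
move=> AK n An; suff : (A `&` carrier) (far_pt n) by rewrite AK.
by split => //; left; exists n.+1.
Qed.

Let carrier_base A : A `&` carrier = set0 -> forall n, ~ A (base_pt n).
Proof.
move=> AK n An; suff : (A `&` carrier) (base_pt n) by rewrite AK.
by split => //; left; exists 0%N.
Qed.

Lemma z_chain : chains z.
Proof.
split; first by apply: signed_measureB; apply: signed_real_measure; exact: finT.
exists carrier; split; first by apply: compact_for_cvg_seq; exact: co_cvg_pt.
move=> A mA AK; rewrite /z !real_measureE// !atoms_null ?subrr//.
  exact: carrier_base.
exact: carrier_far.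
Qed.

Lemma ztrunc_chain N : chains (ztrunc N).
Proof.
split; first by apply: signed_measureB; apply: signed_real_measure; exact: finT_upto.
exists carrier; split; first by apply: compact_for_cvg_seq; exact: co_cvg_pt.
move=> A mA AK; rewrite /ztrunc !real_measureE// !atoms_upto_null ?subrr//.
  exact: carrier_base.
exact: carrier_far.
Qed.

Definition arc_path n : cmapB gamma 1 :=
  curve_arc gamma (introT andP (conj (absc_gt0 R 0) (absc_le R 0)))
                  (introT andP (conj (absc_gt0 R n.+1) (absc_le R n.+1))).

Lemma ev0_arc_path n : ev (edge 0) (arc_path n) = pt 0.
Proof. by apply: cmap_ext => t; exact: curve_arc0. Qed.

Lemma ev1_arc_path n : ev (edge 1) (arc_path n) = pt n.+1.
Proof. by apply: cmap_ext => t; exact: curve_arc1. Qed.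

(** It bounds the weighted sum of Dirac masses at the arcs of the curve from the base point to the
    first [N] far points. *)
Lemma ztrunc_boundary N : boundaries (ztrunc N).
Proof.
exists (real_measure (atoms_upto b arc_path N)).
  split; first by apply: signed_real_measure; exact: finT_upto.
  (* A finite family of arcs, written as an eventually constant sequence to reuse
     [compact_for_cvg_seq]. *)
  exists (range (fun n => arc_path (minn n N)) `|` [set arc_path N]); split.
    apply: compact_for_cvg_seq => U _ UN; near=> n.
    by rewrite (minn_idPr _)//; near: n; exists N.
  move=> A mA AK; rewrite real_measureE// atoms_uptoE big1// => n _.
  rewrite indicE memNset ?mulr0// => An.
  suff : (A `&` (range (fun n => arc_path (minn n N)) `|` [set arc_path N])) (arc_path n).
    by rewrite AK.
  by split=> //; left; exists n => //; rewrite (minn_idPl _)// ltnW.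
apply/funext => A; have [mA|nmA] := pselect (measurable A); last first.
  by rewrite /bd /ztrunc /real_measure !asboolF// subrr.
rewrite bdE// /ztrunc !real_measureE ?atoms_uptoE//; try exact: measurable_ev_preimage.
rewrite /=; congr (_ - _); apply: eq_bigr => n _; congr (_ * _).
  by apply: indic_iff; rewrite /= ev1_arc_path.
by apply: indic_iff; rewrite /= ev0_arc_path.
Unshelve. all: by end_near. Qed.

(** A common Hahn set for [z] and every [ztrunc N]. *)
Let P : set (cmapB gamma 0) := ~` [set pt 0].

Let mP : measurable P.
Proof. by apply: measurableC; exact: measurable_singleton. Qed.

Let base_P n : ~ P (base_pt n).
Proof. by move=> /(_ erefl). Qed.

Let far_P n : ~ (~` P) (far_pt n).
Proof. by rewrite /P setCK => /pt_inj. Qed.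

Lemma Lambda_ztrunc_cvg (f : cmap gamma 0 -> R) : cont_fun f ->
  (fun N => Lambda f (ztrunc N)) @ \oo --> Lambda f z.
Proof.
move=> cf; rewrite /z (Lambda_sing f (finT _) (finT _) mP); last 2 first.
- by apply: atoms_null; exact: base_P.
- by apply: atoms_null; exact: far_P.
have -> : (fun N => Lambda f (ztrunc N)) =
    (fun N => fine (\int[atoms_upto b far_pt N]_x (f x)%:E)%E -
              fine (\int[atoms_upto b base_pt N]_x (f x)%:E)%E).
  apply/funext => N; apply: (Lambda_sing f (finT_upto _ _) (finT_upto _ _) mP).
    by apply: atoms_upto_null; exact: base_P.
  by apply: atoms_upto_null; exact: far_P.
have fcvg : f (pt n) @[n --> \oo] --> f (limit_pt gamma).
  move=> U; rewrite nbhsE => -[V [oV Vl] VU].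
  by have := co_cvg_pt (cf V oV) Vl; apply: filterS => n; exact: VU.
(* Convergence at the limit point bounds [f] along the atoms; every number above [C] is a bound,
   hence [C + 1]. *)
have [C [_ CP]] := cvg_seq_bounded (cvgP _ fcvg).
have {}CP n : `|f (pt n)| <= C + 1 by apply: CP => //; rewrite ltrDl.
by apply: cvgB; apply: (integral_atoms_cvg bfin (C := C + 1));
  rewrite ?/far_pt ?/base_pt//; exact: measurable_cont.
Qed.

Let far_set n : set (cmapB gamma 0) := [set s : cmap gamma 0 | tail n (s (vertex R))].

Let end_set (t : R) n : set (cmapB gamma 1) := [set s : cmap gamma 1 | tail n (trace s t)].

Let far_setE t n : ev (edge t) @^-1` far_set n = end_set t n.
Proof. by []. Qed.

Let mfar_set n : measurable (far_set n).
Proof.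
have [V [oV VP]] := tail_relatively_open arc n.
apply: sub_sigma_algebra; rewrite /far_set.
rewrite (_ : [set _ | _] = [set s : cmap gamma 0 | V (s (vertex R))]).
  by apply: gen_open_sub; exact: open_eval.
by apply/seteqP; split=> s /VP; apply; exact: cm_in.
Qed.

Let mend_set t n : measurable (end_set t n).
Proof. by rewrite -far_setE; exact: measurable_ev_preimage. Qed.

Lemma z_far_set m : (2 * m.+1%:R)^-1 <= z (far_set m.+1).
Proof.
rewrite /z !real_measureE// (atoms_null b (q := base_pt)); last first.
  by move=> n /tail_absc.
rewrite subr0.
(* With [2m + 1] terms the telescoped sum is [1/(m+1) - 1/(2m+2)], which is the claimed bound. *)
apply: (@le_trans _ _ (fine (atoms_upto b far_pt (m + m.+1) (far_set m.+1)))); last first.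
  apply: fine_le; [| |exact: atoms_upto_le].
    by apply: finite_measure_fin_num => //; exact: finT_upto.
  by apply: finite_measure_fin_num => //; exact: finT.
rewrite atoms_uptoE /=.
have E (n : nat) : \1_(far_set m.+1) (far_pt n) = (m <= n)%N%:R :> R.
  have -> : (m <= n)%N%:R = \1_[set k | (m <= k)%N] n :> R by rewrite indicE mem_setE.
  apply: indic_iff; exact: tail_absc.
under eq_bigr do rewrite E.
rewrite (sum_weight_ge R m m.+1) -addSn addnn -muln2 natrM.
have : m.+1%:R != 0 :> R by [].
move: (m.+1%:R) => x x0; rewrite le_eqVlt; apply/orP; left; apply/eqP.
by field.
Qed.

Lemma z_not_boundary : ~ boundaries z.
Proof.
move=> [mu [smu [K [cK muK]]] bdz].
have [N NP] := compact_tail_bound arc cK.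
(* Step [N + 1] puts [tail (idx l.+1)] inside [tail (idx l + N)], as the crossing bound requires;
   the successor makes [z_far_set] applicable. *)
pose idx l := (l * N.+1).+1.
have idxS l : idx l.+1 = (idx l + N.+1)%N by rewrite /idx mulSn addnC.
have zE l : z (far_set (idx l)) =
    mu (end_set 1 (idx l) `\` end_set 0 (idx l)) - mu (end_set 0 (idx l) `\` end_set 1 (idx l)).
  by rewrite -bdz bdE// !far_setE; exact: signed_measureD.
have tailS l : @tail R (idx l.+1) `<=` tail (idx l).
  by apply: tail_sub; rewrite idxS leq_addr.
have tailN l : @tail R (idx l.+1) `<=` tail (idx l + N).
  by apply: tail_sub; rewrite idxS leq_add2l.
have cv1 : cvgn (fun n => \sum_(i < n) mu (end_set 1 (idx i) `\` end_set 0 (idx i))).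
  apply: (cvg_sum_difference (E := fun i => end_set 1 (idx i))
    (E' := fun i => end_set 0 (idx i)) smu muK) => // i s.
    by move=> /tailS.
  by move=> [/tailN h /NP/(_ (idx i))[_]]; apply.
have cv0 : cvgn (fun n => \sum_(i < n) mu (end_set 0 (idx i) `\` end_set 1 (idx i))).
  apply: (cvg_sum_difference (E := fun i => end_set 0 (idx i))
    (E' := fun i => end_set 1 (idx i)) smu muK) => // i s.
    by move=> /tailS.
  by move=> [/tailN h /NP/(_ (idx i))[+ _]]; apply.
have cvz : cvgn (series (fun l => z (far_set (idx l)))).
  rewrite (_ : series _ = (fun n =>
    \sum_(i < n) mu (end_set 1 (idx i) `\` end_set 0 (idx i)) -
    \sum_(i < n) mu (end_set 0 (idx i) `\` end_set 1 (idx i)))); first exact: is_cvgB.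
  apply/funext => n.
  by rewrite /series /= big_mkord -sumrB; apply: eq_bigr => l _; rewrite zE.
have cN : 0 < (2 * N.+1%:R)^-1 :> R by rewrite invr_gt0 mulr_gt0.
(* Comparison with a multiple of the harmonic series: [idx l] is at most [(N + 1) * (l + 1)]. *)
have : cvgn (series (fun l => (2 * N.+1%:R)^-1 * harmonic l : R)).
  apply: series_le_cvg cvz => l.
  - by rewrite mulr_ge0// ?ltW// harmonic_gt0.
  - by apply: le_trans (z_far_set _); rewrite invr_ge0 mulr_ge0.
  apply: le_trans (z_far_set _); rewrite /harmonic /= -invfM lef_pV2 ?posrE ?mulr_gt0//.
  rewrite -mulrA ler_pM2l// -natrM ler_nat.
  by rewrite (mulnC N.+1) mulSn addSn ltnS leq_addl.
have -> : series (fun l => (2 * N.+1%:R)^-1 * harmonic l : R) =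
    (fun n => (2 * N.+1%:R)^-1 * series harmonic n).
  by apply/funext => n; rewrite /series /= mulr_sumr.
move=> h; apply: (@dvg_harmonic R).
rewrite (_ : series _ = (fun n => 2 * N.+1%:R * ((2 * N.+1%:R)^-1 * series harmonic n))).
  exact: is_cvgMr.
apply/funext => n.
by rewrite mulrA divff ?mul1r// gt_eqF// -invr_gt0.
Qed.

(** An open set around the class of [z] pulls back to an open set of cycles around [z]. This
    contains some [ztrunc N], whose class is zero, so the two classes have no disjoint
    neighbourhoods. *)
Lemma not_H0_hausdorff : ~ H0_hausdorff gamma.
Proof.
move=> haus.
have zero_chain : chains ((fun=> 0) : set (cmapB gamma 0) -> R).
  have <- : (fun A => z A - z A) = (fun=> 0) by apply/funext => A; rewrite subrr.
  by apply: chainsB; exact: z_chain.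
have zero_bd : boundaries ((fun=> 0) : set (cmapB gamma 0) -> R).
  have <- : (fun A => ztrunc 0 A - ztrunc 0 A) = (fun=> 0).
    by apply/funext => A; rewrite subrr.
  by apply: boundariesB; exact: ztrunc_boundary.
have zz : coset0 z z.
  by exists (fun=> 0); split=> //; apply/funext => A; rewrite addr0.
have ne : coset0 z <> coset0 ((fun=> 0) : set (cmapB gamma 0) -> R).
  move=> E; rewrite E in zz; have [c [bc zc]] := zz; apply: z_not_boundary.
  by rewrite zc (_ : (fun A => 0 + c A) = c)//; apply/funext => A; rewrite add0r.
have H0z : H0 (coset0 z) by exists z => //; exact: z_chain.
have H00 : H0 (coset0 ((fun=> 0) : set (cmapB gamma 0) -> R)) by exists (fun=> 0).
have [UU [VV [[_ oUU] [_ [Uz [V0 UV]]]]]] := haus _ _ H0z H00 ne.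
have [Q [[_ oQ] QE]] := oUU.
have Qz : Q z.
  suff : (Q `&` @cycles0 R gamma) z by case.
  by rewrite -QE; split => //; exact: z_chain.
have [n [f [U [fU UQ]]]] := oQ _ Qz.
(* A basic neighbourhood involves finitely many functionals, so one [N] works for all of them. *)
have : \forall N \near \oo, forall i : 'I_n, U i (Lambda (f i) (ztrunc N)).
  apply: filter_forall => i; have [cf [oUi Uz']] := fU i (ltn_ord i).
  by apply: (Lambda_ztrunc_cvg cf); exact: open_nbhs_nbhs.
move=> [N _ /(_ N (leqnn N)) UN].
have QN : Q (ztrunc N).
  apply: UQ; first exact: ztrunc_chain.
  by move=> i ni; exact: (UN (Ordinal ni)).
have : (Q `&` @cycles0 R gamma) (ztrunc N) by split => //; exact: ztrunc_chain.
rewrite -QE => -[_]; rewrite (coset0_boundary (ztrunc_boundary N)) => U0.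
suff : (UU `&` VV) (coset0 (fun=> 0)) by rewrite UV.
by split.
Qed.

End NonHausdorff.

(** The zeroth Milnor-Thurston homology H_0(W) of the Warsaw circle, with the
    Berlanga topology, is not Hausdorff (for any choice of the closing arc). *)
Theorem theorem6 (R : realType) (gamma : R -> R * R) :
  warsaw_arc gamma -> ~ H0_hausdorff gamma.
Proof. exact: not_H0_hausdorff. Qed.
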